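(* Let $T$ be a finite tree, let $L(T)$ be its line graph, and let $I(L(T))\subseteq R=\Bbbk[e_{uv}:\{u,v\}\in E(T)]$ be the edge ideal of $L(T)$, where $\Bbbk$ is a field. Then $I(L(T))$ has a linear resolution if and only if $T$ is one of the following: (i) a star graph; (ii) a broom of diameter $3$; (iii) a (partially) whiskered star; (iv) a path $P_n$ with $2\leq n\leq 5$.
   Context: All graphs are finite and simple. The line graph $L(G)$ of a graph $G$ has vertex set $E(G)$, two vertices being adjacent iff the corresponding edges of $G$ share a vertex. For a graph $H$ with vertex set $V$, its edge ideal is $I(H)=\langle x_ux_v:\{u,v\}\in E(H)\rangle$ in the polynomial ring over $\Bbbk$ with one variable per vertex; for $L(T)$ the variables are $e_{uv}$, one for each edge $\{u,v\}$ of $T$. An ideal has a linear resolution if it is generated in degree $2$ and its minimal graded free resolution is linear (equivalently $\operatorname{reg} R/I=1$). A star is the graph with vertices $u,v_1,\dots,v_n$ and edges $\{u,v_i\}$. The path $P_n$ has vertices $u_1,\dots,u_n$ and edges $\{u_i,u_{i+1}\}$. A broom is obtained from a path $P_n$ by attaching $m$ new vertices by pendant edges to the first (or last) vertex of $P_n$; its diameter is the maximum distance between two vertices. A whiskered graph of $G$ is obtained by attaching to each vertex of $G$ a new pendant edge (with a new vertex); a partially whiskered graph is obtained by doing this only for the vertices in some subset of $V(G)$. A (partially) whiskered star is a (partially) whiskered graph of a star. *)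

(* Defs.v *)
From HB Require Import structures.
From mathcomp Require Import all_boot all_order all_algebra.
From mathcomp Require Import mpoly.
Set Implicit Arguments. Unset Strict Implicit. Unset Printing Implicit Defensive.
Import GRing.Theory.
Local Open Scope ring_scope.

Definition simple_graph (V : finType) (e : rel V) : Prop :=
  ssrbool.symmetric e /\ ssrbool.irreflexive e.

Definition acyclic (V : finType) (e : rel V) : Prop :=
  ~ (exists p : seq V, [/\ uniq p, (2 < size p)%N & path.cycle e p]).

Definition connected (V : finType) (e : rel V) : Prop :=
  forall x y : V, connect e x y.

Definition is_tree (V : finType) (e : rel V) : Prop :=
  [/\ simple_graph e, (0 < #|V|)%N, connected e & acyclic e].

Definition edges (V : finType) (e : rel V) : {set {set V}} :=
  [set s : {set V} | [exists x, exists y, e x y && (s == [set x; y])]].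

Definition line_graph (V : finType) (e : rel V) : rel 'I_#|edges e| :=
  fun i j => (i != j) &&
    (enum_val (A := edges e) i :&: enum_val (A := edges e) j != set0).

Arguments line_graph {V} e _ _.

Definition is_star (V : finType) (e : rel V) : Prop :=
  exists u : V, forall x y : V, e x y = (x != y) && ((x == u) || (y == u)).

Definition is_path_graph (V : finType) (e : rel V) (n : nat) : Prop :=
  exists p : seq V, [/\ size p = n, uniq p, (forall x, x \in p) &
    forall x y, e x y = ((index x p).+1 == index y p) || ((index y p).+1 == index x p)].

Definition is_broom (V : finType) (e : rel V) (n m : nat) : Prop :=
  exists (p w : seq V), [/\ size p = n, (0 < n)%N, size w = m, uniq (p ++ w) &
    (forall x, x \in p ++ w)] /\
    forall x y, e x y =
      [|| (x \in p) && (y \in p) &&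
            (((index x p).+1 == index y p) || ((index y p).+1 == index x p)),
          (x \in w) && (y == head x p) |
          (y \in w) && (x == head y p)].

Definition has_diameter (V : finType) (e : rel V) (d : nat) : Prop :=
  (forall x y : V, exists s : seq V, [/\ (size s <= d)%N, path e x s & last x s = y]) /\
  (exists x y : V, forall s : seq V, path e x s -> last x s = y -> (d <= size s)%N).

(* partially whiskered star: a star with center u and leaf set L, plus a set W of
   new pendant vertices, each w in W attached to f w in {u} u L, f injective on W
   (so each star vertex gets at most one whisker).  W may be empty (plain star)
   or cover all star vertices (whiskered star). *)
Definition is_pw_star (V : finType) (e : rel V) : Prop :=
  exists (u : V) (L W : {set V}) (f : V -> V),
    [/\ u \notin L, u \notin W, [disjoint L & W] &
        (forall x, [|| x == u, x \in L | x \in W])] /\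
    [/\ {in W &, injective f},
        (forall w, w \in W -> (f w == u) || (f w \in L)) &
        forall x y, e x y =
          [|| (x == u) && (y \in L), (y == u) && (x \in L),
              (x \in W) && (y == f x) | (y \in W) && (x == f y)]].

Definition edge_ideal (K : fieldType) (m : nat) (H : rel 'I_m) (p : {mpoly K[m]}) : Prop :=
  exists c : 'I_m -> 'I_m -> {mpoly K[m]},
    p = \sum_(i < m) \sum_(j < m | H i j) c i j * 'X_i * 'X_j.

(* I has a (2-)linear resolution: there is a finite graded free resolution
     0 <- I <-g- F_0 <-d_0- F_1 <-d_1- F_2 <- ... ,  F_i = R(-2-i)^{b_i},
   i.e. generators g of I homogeneous of degree 2, all differential matrices with
   entries homogeneous linear forms, exact everywhere, F_i = 0 for i >= L.
   Elements of F_i are row vectors; the map F_{i+1} -> F_i is u |-> u *m d i. *)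
Definition linear_resolution (K : fieldType) (m : nat) (I : {mpoly K[m]} -> Prop) : Prop :=
  exists (L : nat) (b : nat -> nat) (g : 'cV[{mpoly K[m]}]_(b 0%N))
         (d : forall i : nat, 'M[{mpoly K[m]}]_(b i.+1, b i)),
  [/\ (forall k, g k 0 \is 2.-homog),
      (forall i k l, d i k l \is 1.-homog) &
      (forall p, I p <-> exists u : 'rV_(b 0%N), p = (u *m g) 0 0)] /\
  [/\ d 0%N *m g = 0,
      (forall u : 'rV_(b 0%N), u *m g = 0 -> exists v : 'rV_(b 1%N), u = v *m d 0%N),
      (forall i, d i.+1 *m d i = 0),
      (forall i (u : 'rV_(b i.+1)), u *m d i = 0 -> exists v : 'rV_(b i.+2), u = v *m d i.+1) &
      (forall i, (L <= i)%N -> b i = 0%N)].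

(* Main.v *)
Require Import Defs.
From mathcomp Require Import all_boot all_order all_algebra.
From mathcomp Require Import mpoly zify.

(** By Froeberg's theorem the edge ideal of [L(T)] should have a linear resolution
    exactly when the complement of [L(T)] is chordal; for a tree this means that
    [L(T)] has no induced [2K_2], i.e. that [T] has no two disjoint paths on three
    vertices.

    An induced [2K_2] on edges [ab], [cd] yields the Koszul syzygy between [X_a X_b]
    and [X_c X_d], which has degree 2 and whose [X_c X_d]-coefficient on the generator
    [X_a X_b] cannot be produced by linear syzygies.

    If all 3-vertex paths of [T] meet pairwise, a Helly-type argument gives a vertex
    [u] on all of them, so [T] is a star at [u] with at most one whisker on each leaf;
    every tree of the list has such a [u]. Then [L(T)] is a clique with at most one
    pendant vertex attached to each of its vertices. Its edges can be ordered so that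
    each successive colon ideal is generated by variables; resolving these by Koszul
    complexes and gluing with the horseshoe construction gives a linear resolution. *)

Set Implicit Arguments.
Unset Strict Implicit.
Unset Printing Implicit Defensive.

Import GRing.Theory.
Local Open Scope ring_scope.

(** * Matrices of linear forms and the gluing of their resolutions *)

Section LinearMatrices.

Variables (K : fieldType) (n : nat).
Local Notation R := {mpoly K[n]}.

Definition homog_mx d a b (A : 'M[R]_(a, b)) := forall i j, A i j \is d.-homog.

(** By linearity [p] may be taken to be a monomial; then both sides are the whole product or zero,
    according to whether its degree is [d]. *)
Lemma pihomogM d k (p q : R) :
  q \is k.-homog -> pihomog mdeg (d + k) (p * q) = pihomog mdeg d p * q.
Proof.
move=> hq; elim/mpolyind: p => [|c m p _ _ IH]; first by rewrite mul0r !pihomog0 mul0r.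
rewrite mulrDl !pihomogD IH mulrDl; congr (_ + _).
rewrite -scalerAl !linearZ /= -scalerAl; congr (_ *: _).
rewrite pihomogX; have hm : 'X_[m] * q \is (mdeg m + k).-homog.
  by apply: dhomogM => //; rewrite dhomogX.
have [<-|ne] := eqVneq; first by rewrite pihomog_dE.
by rewrite (pihomog_ne0 _ hm) ?mul0r // eqn_add2r.
Qed.

Lemma homog_mxM d k a b c (A : 'M[R]_(a, b)) (B : 'M[R]_(b, c)) :
  homog_mx d A -> homog_mx k B -> homog_mx (d + k) (A *m B).
Proof.
by move=> hA hB i j; rewrite mxE; apply: rpred_sum => l _; apply: dhomogM.
Qed.

(** The degree-[d] parts of the entries of an arbitrary lift still form a lift, because [A] is
    homogeneous. This keeps connecting matrices linear. *)
Lemma homog_lift d k a b c (A : 'M[R]_(b, c)) (B : 'M[R]_(a, c)) :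
    homog_mx k A -> homog_mx (d + k) B ->
    (forall i, exists u : 'rV_b, row i B = u *m A) ->
  exists2 P : 'M[R]_(a, b), homog_mx d P & B = P *m A.
Proof.
move=> hA hB lift.
have {}lift i : exists u : 'rV_b, row i B == u *m A.
  by have [u ->] := lift i; exists u.
exists (\matrix_(i, j) pihomog mdeg d (xchoose (lift i) 0 j)).
  by move=> i j; rewrite mxE; apply: pihomogP.
apply/matrixP => i j; rewrite -(pihomog_dE (hB i j)).
have /eqP/matrixP/(_ 0 j) := xchooseP (lift i); rewrite !mxE => ->.
by rewrite linear_sum /=; apply: eq_bigr => l _; rewrite pihomogM ?mxE.
Qed.

(** Exactness at the middle of [R^a -> R^b -> R^c], the maps acting on row vectors. *)
Definition presents a b c (M : 'M[R]_(b, c)) (D : 'M[R]_(a, b)) :=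
  D *m M = 0 /\ forall u : 'rV_b, u *m M = 0 -> exists v : 'rV_a, u = v *m D.

(* The row kernel of [M] has a linear free resolution of length at most [k]. *)
Fixpoint linres k b c (M : 'M[R]_(b, c)) : Prop :=
  if k is k'.+1 then
    exists (a : nat) (D : 'M[R]_(a, b)),
      [/\ homog_mx 1 D, presents M D & linres k' D]
  else b = 0%N.

Lemma linres0 b c (M : 'M[R]_(b, c)) k : b = 0%N -> linres k M.
Proof.
elim: k b c M => [//|k IH] b c M b0; exists 0%N, 0; split; last exact: IH.
  by move=> i j; rewrite mxE dhomog0.
split=> [|u _]; first by rewrite mul0mx.
by exists 0; subst b; rewrite !thinmx0.
Qed.

Lemma linresW k l b c (M : 'M[R]_(b, c)) : (k <= l)%N -> linres k M -> linres l M.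
Proof.
elim: k l b c M => [|k IH] [|l] b c M //= le_kl; first by move/(linres0 M l.+1).
by case=> a [D [hD pD rD]]; exists a, D; split=> //; apply: IH rD.
Qed.

(** A kernel vector [(v, w)] has [v = x C']; subtracting [x (C', P)] leaves [w - x P], which lies in
    the kernel of [A] and so comes from [A']. *)
Lemma presents_block a b c a' b' c' (A : 'M[R]_(a, c)) (A' : 'M[R]_(b, a))
    (C : 'M[R]_(a', c')) (C' : 'M[R]_(b', a')) (F : 'M[R]_(a', c)) (P : 'M[R]_(b', a)) :
  presents A A' -> presents C C' -> C' *m F + P *m A = 0 ->
  presents (block_mx C F 0 A) (block_mx C' P 0 A').
Proof.
move=> [A'A exA] [C'C exC] defP; split.
  by rewrite mulmx_block !mulmx0 !mul0mx C'C A'A !addr0 defP block_mx0.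
move=> u; rewrite -[u]hsubmxK; set v := lsubmx u; set w := rsubmx u.
rewrite mul_row_block mulmx0 addr0 -row_mx0 => /eq_row_mx [/exC [x ->] hw].
have [|y hy] := exA (w - x *m P).
  rewrite mulmxBl -[x *m P *m A]mulmxA -(addr0_eq defP) mulmxN opprK mulmxA addrC.
  exact: hw.
exists (row_mx x y); rewrite mul_row_block mulmx0 addr0 -hy.
by rewrite addrC subrK.
Qed.

(* The horseshoe construction: [F] is the connecting map at the current step. *)
Lemma linres_block k a c a' c' (A : 'M[R]_(a, c)) (C : 'M[R]_(a', c')) (F : 'M[R]_(a', c)) :
    homog_mx 1 A -> homog_mx 1 F ->
    (forall v : 'rV_a', v *m C = 0 -> exists u : 'rV_a, v *m F = u *m A) ->
  linres k A -> linres k C -> linres k (block_mx C F 0 A).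
Proof.
elim: k a c a' c' A C F => [|k IH] a c a' c' A C F hA hF hyp /=.
  by move=> -> ->.
move=> [b [A' [hA' pA rA]]] [b' [C' [hC' pC rC]]].
(* The next connecting map solves [P A = - C' F]; it exists because the rows of [C'] are syzygies of
   [C], to which [hyp] applies. *)
have [|i|P hP defP] := homog_lift (d := 1) (B := - (C' *m F)) hA.
- by move=> i j; rewrite mxE rpredN; apply: (homog_mxM (d := 1) (k := 1)).
- have [|u hu] := hyp (row i C'); first by rewrite -row_mul pC.1 row0.
  by exists (- u); rewrite raddfN /= row_mul hu mulNmx.
exists (b' + b)%N, (block_mx C' P 0 A'); split.
- move=> i j; rewrite -[i]splitK -[j]splitK.
  case: (split i) => i'; case: (split j) => j' /=;
    by rewrite ?(block_mxEul, block_mxEur, block_mxEdl, block_mxEdr) // mxE dhomog0.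
- by apply: presents_block => //; rewrite -defP addrN.
- apply: IH => // v hv; apply: pA.2.
  by rewrite -mulmxA -defP mulmxN mulmxA hv mul0mx oppr0.
Qed.

(** The syzygies of [(m, g)] are generated by those of [g] and one for each generator [X_i] of the
    colon ideal [(g) : m], with first coordinate [X_i]. Their block matrix is resolved by
    [linres_block]. *)
Lemma linres_col d k s b (g : 'cV[R]_b) (m : 'cV[R]_1) (X : 'cV[R]_s) :
    homog_mx d g -> homog_mx d m -> homog_mx 1 X ->
    (forall i, exists u : 'rV_b, row i X *m m = u *m g) ->
    (forall v : 'rV_1, (exists u : 'rV_b, v *m m = u *m g) ->
      exists w : 'rV_s, v = w *m X) ->
  linres k.+1 g -> linres k X -> linres k.+1 (col_mx m g).
Proof.
move=> hg hm hX sub colon [a [D [hD pD rD]]] rX.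
have [|i|P hP defP] := homog_lift (d := 1) (B := - (X *m m)) hg.
- by move=> i j; rewrite mxE rpredN; apply: homog_mxM.
- have [u hu] := sub i; exists (- u).
  by rewrite raddfN /= row_mul hu mulNmx.
exists (s + a)%N, (block_mx X P 0 D); split.
- move=> i j; rewrite -[i]splitK -[j]splitK.
  case: (split i) => i'; case: (split j) => j' /=;
    by rewrite ?(block_mxEul, block_mxEur, block_mxEdl, block_mxEdr) // mxE dhomog0.
- split.
    by rewrite mul_block_col -defP addrN mul0mx pD.1 addr0 col_mx0.
  move=> u; rewrite -[u]hsubmxK; set v := lsubmx u; set w := rsubmx u.
  rewrite mul_row_col => hvw.
  have [|x hx] := colon v.
    by exists (- w); rewrite mulNmx; apply/eqP; rewrite -addr_eq0 hvw.
  have [|y hy] := pD.2 (w - x *m P).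
    by rewrite mulmxBl -mulmxA -defP mulmxN opprK mulmxA -hx addrC.
  exists (row_mx x y); rewrite mul_row_block mulmx0 addr0 -hy -hx.
  by rewrite addrC subrK.
- apply: linres_block => // v hv; apply: pD.2.
  by rewrite -mulmxA -defP mulmxN mulmxA hv mul0mx oppr0.
Qed.

End LinearMatrices.

(** * Ideals given by generators, and colon ideals generated by variables *)

Section Resolutions.

Variables (K : fieldType) (n : nat).
Local Notation R := {mpoly K[n]}.

(* The quantification over [Q] says that [g] and [M] are equal, including their
   numbers of rows, which are not convertible. *)
Lemma linres_seq k b0 c (M : 'M[R]_(b0, c)) : linres k M ->
  exists (L : nat) (b : nat -> nat) (g : 'M[R]_(b 0%N, c))
         (d : forall i : nat, 'M[R]_(b i.+1, b i)),
    [/\ forall Q : (forall a, 'M[R]_(a, c) -> Prop), Q _ M -> Q _ g,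
        forall i, homog_mx 1 (d i), presents g (d 0%N),
        forall i, presents (d i) (d i.+1) &
        forall i, (L <= i)%N -> b i = 0%N].
Proof.
elim: k b0 c M => [|k IH] b0 c M /=.
  move=> b00; subst b0; exists 0%N, (fun=> 0%N), M, (fun=> 0); split=> //.
  - by move=> i j; case.
  - by split=> [|u _]; [rewrite mul0mx | exists 0; rewrite !thinmx0].
  - by split=> [|u _]; [rewrite mul0mx | exists 0; rewrite !thinmx0].
case=> a [D [hD pD /IH [L [b [g [d [defg hd pg pd Lb]]]]]]].
exists L.+1, (fun i => if i is i'.+1 then b i' else b0), M.
exists (fun i => if i is i'.+1 return
                    'M[R]_(b i, if i is i'.+1 then b i' else b0) then d i' else g).
split=> //.
- by case=> [|i] //; apply: (defg (fun _ => @homog_mx _ _ 1 _ _)).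
- exact: (defg (fun _ => presents M)).
- by case.
- by case.
Qed.

Definition colv (s : seq R) : 'cV[R]_(size s) := \col_i s`_i.

Definition ideal (s : seq R) (p : R) : Prop :=
  exists u : 'rV_(size s), p = (u *m colv s) 0 0.

Lemma colv_cons x s : colv (x :: s) = col_mx (\col_(i < 1) x) (colv s).
Proof.
apply/colP => i; rewrite [LHS]mxE.
case: (@split_ordP 1 (size s) i) => j ->.
  by apply: etrans (esym (col_mxEu _ _ _ _)); rewrite mxE; case: j => [[]].
by apply: etrans (esym (col_mxEd _ _ _ _)); rewrite mxE.
Qed.

Lemma ideal_nil p : ideal [::] p <-> p = 0.
Proof.
split=> [[u ->]|->]; first by rewrite mxE big_ord0.
by exists 0; rewrite mul0mx mxE.
Qed.

Lemma ideal_cons x s p : ideal (x :: s) p <-> exists a q, ideal s q /\ p = a * x + q.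
Proof.
split=> [[u ->]|[a [q [[u ->] ->]]]].
  exists (u 0 ord0), (((\row_j u 0 (lift ord0 j)) *m colv s) 0 0).
  split; first by exists (\row_j u 0 (lift ord0 j)).
  rewrite mxE big_ord_recl !mxE; congr (_ + _).
  by apply: eq_bigr => j _; rewrite !mxE.
exists (\row_j if unlift ord0 j is Some i then u 0 i else a).
rewrite !mxE big_ord_recl !mxE unlift_none; congr (_ + _).
by apply: eq_bigr => j _; rewrite !mxE liftK.
Qed.

Lemma ideal0 s : ideal s 0.
Proof. by exists 0; rewrite mul0mx mxE. Qed.

Lemma idealD s p q : ideal s p -> ideal s q -> ideal s (p + q).
Proof. by move=> [u ->] [v ->]; exists (u + v); rewrite mulmxDl [RHS]mxE. Qed.

Lemma idealM s a p : ideal s p -> ideal s (a * p).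
Proof. by move=> [u ->]; exists (a *: u); rewrite -scalemxAl [RHS]mxE. Qed.

Lemma ideal_mem s p : p \in s -> ideal s p.
Proof.
elim: s => // x s IH; rewrite inE => /predU1P[->|/IH ps]; apply/ideal_cons.
  by exists 1, 0; rewrite mul1r addr0; split=> //; apply: ideal0.
by exists 0, p; rewrite mul0r add0r.
Qed.

Lemma ideal_gen (P : R -> Prop) s :
    P 0 -> (forall p q, P p -> P q -> P (p + q)) -> (forall a p, P p -> P (a * p)) ->
  (forall p, p \in s -> P p) -> forall p, ideal s p -> P p.
Proof.
move=> P0 PD PM; elim: s => [|x s IH] Ps p; first by move/ideal_nil ->.
case/ideal_cons=> a [q [sq ->]]; apply: PD; first by apply/PM/Ps; rewrite mem_head.
by apply: IH sq => r rs; apply: Ps; rewrite inE rs orbT.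
Qed.

Definition has_linres (s : seq R) := exists k, linres k (colv s).

Lemma linear_resolution_of_linres s (I : R -> Prop) :
    {in s, forall p, p \is 2.-homog} -> (forall p, I p <-> ideal s p) ->
  has_linres s -> linear_resolution I.
Proof.
move=> hs Is [k /linres_seq [L [b [g [d [defg hd pg pd Lb]]]]]].
exists L, b, g, d; split; split=> //.
- move=> j; apply: (defg (fun a M => forall j, M j 0 \is 2.-homog)) => {}j.
  by rewrite mxE hs ?mem_nth.
- pose Q a (M : 'cV[R]_a) := forall p, I p <-> exists u : 'rV_a, p = (u *m M) 0 0.
  exact: (defg Q).
- exact: pg.1.
- exact: pg.2.
- by move=> i; exact: (pd i).1.
- by move=> i; exact: (pd i).2.
Qed.

Lemma mx11_eq (A B : 'M[R]_1) : A 0 0 = B 0 0 -> A = B.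
Proof. by move=> AB; apply/matrixP => i j; rewrite !ord1. Qed.

Lemma has_linres_cons d m s X :
    {in s, forall p, p \is d.-homog} -> m \is d.-homog ->
    {in X, forall p, p \is 1.-homog} ->
    {in X, forall x, ideal s (x * m)} -> (forall v, ideal s (v * m) -> ideal X v) ->
  has_linres s -> has_linres X -> has_linres (m :: s).
Proof.
move=> hs hm hX sub colon [k rs] [l rX]; exists (maxn k l).+1; rewrite colv_cons.
apply: (linres_col (d := d) (X := colv X)).
- by move=> i j; rewrite mxE hs ?mem_nth.
- by move=> i j; rewrite mxE.
- by move=> i j; rewrite mxE hX ?mem_nth.
- move=> i; have [|u hu] := sub X`_i; first by rewrite mem_nth.
  by exists u; apply: mx11_eq; rewrite -hu mxE big_ord1 !mxE.
- move=> v [u hu]; have [|w hw] := colon (v 0 0).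
    by exists u; rewrite -hu mxE big_ord1 mxE.
  by exists w; apply: mx11_eq.
- by apply: linresW rs; apply/leqW/leq_maxl.
- by apply: linresW rX; apply/leq_maxr.
Qed.

(** The quotient by the variables of [S], realised as an endomorphism of [R] so that its values stay
    in a domain. *)
Definition kill (S : seq 'I_n) : R -> R :=
  comp_mpoly [tuple if i \in S then 0 else 'X_i | i < n].

Lemma killX S i : kill S 'X_i = if i \in S then 0 else 'X_i.
Proof. by rewrite /kill comp_mpolyXU -tnth_nth tnth_mktuple. Qed.

Lemma killD S p q : kill S (p + q) = kill S p + kill S q.
Proof. exact: comp_mpolyD. Qed.

Lemma killM S p q : kill S (p * q) = kill S p * kill S q.
Proof. exact: rmorphM. Qed.

Definition vars (S : seq 'I_n) : seq R := [seq 'X_i | i <- S].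

Lemma ideal_vars S i : i \in S -> ideal (vars S) 'X_i.
Proof. by move=> iS; apply: ideal_mem; apply: map_f. Qed.

Lemma vars_homog S : {in vars S, forall p, p \is 1.-homog}.
Proof. by move=> p /mapP [i _ ->]; rewrite dhomogX /= mdeg1. Qed.

(** The property is stable under sums and products, so constants and variables suffice. *)
Lemma sub_kill S p : ideal (vars S) (p - kill S p).
Proof.
pose P q := ideal (vars S) (q - kill S q).
have PM q r : P q -> P r -> P (q * r).
  rewrite /P killM => Pq Pr.
  have -> : q * r - kill S q * kill S r =
      r * (q - kill S q) + kill S q * (r - kill S r).
    by rewrite !mulrBr [r * q]mulrC [r * kill S q]mulrC addrA subrK.
  by apply: idealD; apply: idealM.
have PX i : P 'X_i.
  rewrite /P killX; case: ifP => [/ideal_vars|_]; first by rewrite subr0.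
  by rewrite subrr; apply: ideal0.
have PC c : P c%:MP by rewrite /P /kill comp_mpolyC subrr; apply: ideal0.
rewrite -/(P p); elim/mpolyind: p => [|c m p _ _ Pp]; first by rewrite -mpolyC0.
have Pm : P (c *: 'X_[m]).
  rewrite -mul_mpolyC mpolyXE_id; apply: (PM); first exact: PC.
  apply: (big_ind P) => [||i _]; [by rewrite -mpolyC1 | exact: PM |].
  elim: (m i) => [|k IH]; first by rewrite expr0 -mpolyC1.
  by rewrite exprS; apply: (PM).
by rewrite /P killD opprD addrACA; apply: idealD.
Qed.

Lemma kill_ideal S s p : {in s, forall q, kill S q = 0} -> ideal s p -> kill S p = 0.
Proof.
move=> Ss; move: p; apply: ideal_gen => //.
- by rewrite /kill comp_mpoly0.
- by move=> p q; rewrite killD => -> ->; rewrite addr0.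
- by move=> a p; rewrite killM => ->; rewrite mulr0.
Qed.

(** [kill S] is a ring morphism into a domain that kills [v * m] but not [m], so it kills [v]; then
    [sub_kill] applies. *)
Lemma colon_vars S s m v :
    {in s, forall q, kill S q = 0} -> kill S m != 0 ->
  ideal s (v * m) -> ideal (vars S) v.
Proof.
move=> Ss nzm /(kill_ideal Ss) /eqP; rewrite killM mulf_eq0 (negPf nzm) orbF.
by move/eqP=> v0; have := sub_kill S v; rewrite v0 subr0.
Qed.

Lemma mpolyX_neq0 i : 'X_i != 0 :> R.
Proof.
apply/eqP => /(congr1 (mcoeff U_(i)%MM)) /eqP.
by rewrite mcoeffX eqxx mcoeff0 oner_eq0.
Qed.

(** A new variable is a nonzerodivisor modulo the others, so the colon ideal is again [vars S] and
    the induction hypothesis serves twice. *)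
Lemma koszul S : uniq S -> has_linres (vars S).
Proof.
elim: S => [_|i S IH /= /andP[iS uS]]; first by exists 0%N.
apply: (has_linres_cons (d := 1) (X := vars S)); do ?exact: vars_homog; try exact: IH.
- by rewrite dhomogX /= mdeg1.
- by move=> x xS; rewrite mulrC; apply: idealM; apply: ideal_mem.
- move=> v; apply: colon_vars; first by move=> q /mapP [j jS ->]; rewrite killX jS.
  by rewrite killX (negPf iS) mpolyX_neq0.
Qed.

(* The hypotheses on [S] make [vars S] generate the colon ideal of [s] by [m]. *)
Lemma has_linres_consX d m s S :
    {in s, forall p, p \is d.-homog} -> m \is d.-homog -> uniq S ->
    {in S, forall i, ideal s ('X_i * m)} ->
    {in s, forall q, kill S q = 0} -> kill S m != 0 ->
  has_linres s -> has_linres (m :: s).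
Proof.
move=> hs hm uS sub Ss nzm rs.
apply: (has_linres_cons (d := d) (X := vars S)) => //; last exact: koszul.
- exact: vars_homog.
- by move=> x /mapP [i iS ->]; apply: sub.
- by move=> v; apply: colon_vars.
Qed.

End Resolutions.

(** * Linear resolution for a clique with pendant vertices *)

Section WhiskeredClique.

Variables (K : fieldType) (n : nat).
Local Notation R := {mpoly K[n]}.

Fixpoint clique_gens (c : seq 'I_n) : seq R :=
  if c is i :: c' then [seq 'X_i * 'X_j | j <- c'] ++ clique_gens c' else [::].

Lemma mem_clique_gens c q : uniq c ->
  q \in clique_gens c <-> exists i j, [/\ i \in c, j \in c, i != j & q = 'X_i * 'X_j].
Proof.
elim: c q => [q _|x c IH q /= /andP[xc uc]]; first by split=> // -[i [j []]].
rewrite mem_cat; split.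
  case/orP=> [/mapP [j jc ->]|/(IH _ uc) [i [j [ic jc ij ->]]]].
    exists x, j; rewrite mem_head inE jc orbT; split=> //.
    by apply: contraNneq xc => ->.
  by exists i, j; rewrite !inE ic jc !orbT.
case=> i [j []]; rewrite !inE => /predU1P[->|ic] /predU1P[->|jc] ij ->.
- by rewrite eqxx in ij.
- by apply/orP; left; apply/mapP; exists j.
- by apply/orP; left; apply/mapP; exists i => //; rewrite mulrC.
- by apply/orP; right; apply/(IH _ uc); exists i, j.
Qed.

Lemma homogXX i j : ('X_i * 'X_j : R) \is 2.-homog.
Proof. by apply: (dhomogM (d := 1) (e := 1)); rewrite dhomogX /= mdeg1. Qed.

Lemma kill_XX S i j :
  kill S ('X_i * 'X_j : R) = if (i \in S) || (j \in S) then 0 else 'X_i * 'X_j.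
Proof.
by rewrite killM !killX; case: ifP => _; rewrite ?mul0r //; case: ifP; rewrite ?mulr0.
Qed.

Lemma kill_XX_neq0 S i j : i \notin S -> j \notin S -> kill S ('X_i * 'X_j : R) != 0.
Proof.
move=> iS jS; rewrite kill_XX (negPf iS) (negPf jS) /=.
by rewrite mulf_neq0 ?mpolyX_neq0.
Qed.

(** At least one end of an edge of the clique [c] differs from [y]. *)
Lemma kill_clique_gens c y q : uniq c -> q \in clique_gens c -> kill (rem y c) q = 0.
Proof.
move=> uc /(mem_clique_gens _ uc) [i [j [ic jc ij ->]]]; rewrite kill_XX.
rewrite !(mem_rem_uniq _ uc) !inE ic jc !andbT.
by case: eqP => [<-|] //=; rewrite eq_sym ij.
Qed.

(** The edges at a new vertex [x] are adjoined one by one. The colon ideal by [X_x X_y] is generated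
    by the variables of [c] other than [y]: each [X_i X_y] is already a generator, and each earlier
    generator contains such a variable. *)
Lemma clique_linres c : uniq c -> has_linres (clique_gens c).
Proof.
elim: c => [_|x c IH /= /andP[xc uc]]; first by exists 0%N.
suff H c2 : uniq c2 -> {subset c2 <= c} ->
    has_linres ([seq 'X_x * 'X_j | j <- c2] ++ clique_gens c) by apply: H.
elim: c2 => [_ _|y c2 IH2 /= /andP[yc2 uc2] sub]; first exact: IH.
have yc : y \in c by rewrite sub ?mem_head.
have sub2 : {subset c2 <= c} by move=> z zc; rewrite sub // inE zc orbT.
apply: (has_linres_consX (d := 2) (S := rem y c)); rewrite ?rem_uniq ?homogXX //.
- move=> p; rewrite mem_cat => /orP[/mapP [j _ ->]|]; first exact: homogXX.
  by case/(mem_clique_gens _ uc) => i [j [_ _ _ ->]]; exact: homogXX.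
- move=> i; rewrite (mem_rem_uniq _ uc) !inE => /andP[iy ic].
  rewrite mulrCA; apply/idealM/ideal_mem; rewrite mem_cat; apply/orP; right.
  by apply/(mem_clique_gens _ uc); exists i, y.
- move=> p; rewrite mem_cat => /orP[/mapP [j jc2 ->]|]; last exact: kill_clique_gens.
  rewrite kill_XX !(mem_rem_uniq _ uc) !inE (sub2 j jc2) andbT.
  by rewrite [j == y](negPf (memPn yc2 _ jc2)) orbT.
- by apply: kill_XX_neq0; rewrite (mem_rem_uniq _ uc) !inE ?eqxx // (negPf xc) andbF.
- exact: IH2.
Qed.

Variables (c : seq 'I_n) (t : 'I_n -> 'I_n).
Hypotheses (uc : uniq c) (tc : forall p, p \notin c -> t p \in c).
Hypothesis t_inj : forall p q, p \notin c -> q \notin c -> t p = t q -> p = q.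

(** Here [c] is the clique and [t p] the clique vertex to which the pendant vertex [p] is
    attached. *)
Definition whisker_gens (w : seq 'I_n) : seq R :=
  [seq 'X_p * 'X_(t p) | p <- w] ++ clique_gens c.

Lemma whisker_gens_homog w : {in whisker_gens w, forall p, p \is 2.-homog}.
Proof.
move=> p; rewrite mem_cat => /orP[/mapP [j _ ->]|]; first exact: homogXX.
by case/(mem_clique_gens _ uc) => i [j [_ _ _ ->]]; exact: homogXX.
Qed.

(** The colon ideal by [X_p X_(t p)] is generated by the variables of [c] other than [t p].
    Injectivity of [t] ensures that the pendant edges adjoined earlier contain such a variable. *)
Lemma whisker_linres w :
  uniq w -> {in w, forall p, p \notin c} -> has_linres (whisker_gens w).
Proof.
elim: w => [|p w IH] /=; first by move=> _ _; exact: clique_linres.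
case/andP=> pw uw wc; have pc : p \notin c by rewrite wc ?mem_head.
have wc' : {in w, forall p, p \notin c} by move=> q qw; rewrite wc // inE qw orbT.
have mem_rm i : (i \in rem (t p) c) = (i != t p) && (i \in c).
  by rewrite (mem_rem_uniq _ uc) !inE.
apply: (has_linres_consX (d := 2) (S := rem (t p) c)); rewrite ?rem_uniq ?homogXX //.
- exact: whisker_gens_homog.
- move=> i; rewrite mem_rm => /andP[iy ic].
  rewrite mulrCA; apply/idealM/ideal_mem; rewrite mem_cat; apply/orP; right.
  by apply/(mem_clique_gens _ uc); exists i, (t p); rewrite tc.
- move=> q; rewrite mem_cat => /orP[/mapP [r rw ->]|]; last exact: kill_clique_gens.
  rewrite kill_XX !mem_rm (tc (wc' _ rw)) andbT.
  case: (t r =P t p) => [/t_inj|_]; last by rewrite orbT.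
  by move=> /(_ (wc' _ rw) pc) rp; rewrite -rp rw in pw.
- by apply: kill_XX_neq0; rewrite mem_rm ?eqxx // (negPf pc) andbF.
- exact: IH.
Qed.

Variable H : rel 'I_n.
Hypothesis Hc : {in c &, forall i j, H i j = (i != j)}.
Hypothesis Hw : forall p q, p \notin c -> H p q = (q == t p).
Hypothesis Hsym : ssrbool.symmetric H.

Lemma edge_ideal_gen i j : H i j -> @edge_ideal K _ H ('X_i * 'X_j).
Proof.
move=> ij; exists (fun k l => if (k == i) && (l == j) then 1 else 0).
rewrite (bigD1 i) //= (bigD1 j) //= !eqxx mul1r !big1 ?addr0 //.
  by move=> k ki; apply: big1 => l _; rewrite (negPf ki) !mul0r.
by move=> l /andP[_ lj]; rewrite (negPf lj) andbF !mul0r.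
Qed.

Lemma edge_ideal_whisker p :
  @edge_ideal K _ H p <-> ideal (whisker_gens [seq i <- enum 'I_n | i \notin c]) p.
Proof.
set w := filter _ _; split.
  case=> a ->; apply: (big_ind (ideal _)); [exact: ideal0 | exact: idealD |].
  move=> i _; apply: (big_ind (ideal _)); [exact: ideal0 | exact: idealD |].
  move=> j Hij; rewrite -mulrA; apply/idealM/ideal_mem; rewrite mem_cat.
  have [ic|ic] := boolP (i \in c); last first.
    apply/orP; left; apply/mapP; exists i; first by rewrite mem_filter ic mem_enum.
    by move: Hij; rewrite Hw // => /eqP ->.
  have [jc|jc] := boolP (j \in c); last first.
    apply/orP; left; apply/mapP; exists j; first by rewrite mem_filter jc mem_enum.
    by move: Hij; rewrite Hsym Hw // => /eqP ->; rewrite mulrC.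
  by apply/orP; right; apply/(mem_clique_gens _ uc); exists i, j; rewrite -Hc.
move: p; apply: ideal_gen.
- by exists (fun _ _ => 0); rewrite big1 // => i _; rewrite big1 // => j _; rewrite !mul0r.
- move=> p q [a ->] [b ->]; exists (fun i j => a i j + b i j).
  rewrite -big_split; apply: eq_bigr => i _; rewrite -big_split.
  by apply: eq_bigr => j _; rewrite !mulrDl.
- move=> x p [a ->]; exists (fun i j => x * a i j).
  rewrite big_distrr; apply: eq_bigr => i _; rewrite big_distrr.
  by apply: eq_bigr => j _; rewrite /= !mulrA.
- move=> p; rewrite mem_cat => /orP[/mapP [i iw ->]|].
    by move: iw; rewrite mem_filter => /andP[ic _]; apply: edge_ideal_gen; rewrite Hw.
  case/(mem_clique_gens _ uc) => i [j [ic jc ij ->]].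
  by apply: edge_ideal_gen; rewrite Hc.
Qed.

Theorem whiskered_clique_linear_resolution : linear_resolution (@edge_ideal K _ H).
Proof.
apply: linear_resolution_of_linres edge_ideal_whisker _.
  exact: whisker_gens_homog.
apply: whisker_linres; first by rewrite filter_uniq ?enum_uniq.
by move=> p; rewrite mem_filter => /andP[].
Qed.

End WhiskeredClique.

(** * An induced [2K_2] excludes a linear resolution *)

Section Obstruction.

Variables (K : fieldType) (n : nat).
Local Notation R := {mpoly K[n]}.

Lemma mcoeffXM (p : R) i m :
  ('X_i * p)@_m = if (0 < m i)%N then p@_(m - U_(i)) else 0.
Proof.
have [mi|mi] := posnP (m i).
  apply/eqP; rewrite mcoeff_eq0; apply/negP => /msuppM_le /allpairsP[[m1 m2]] /=.
  by rewrite msuppX inE => -[/eqP -> _ m12]; move: mi; rewrite m12 mnmDE mnm1E eqxx.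
have {1}-> : m = (U_(i) + (m - U_(i)))%MM.
  apply/mnmP => j; rewrite mnmDE mnmBE mnm1E subnKC //.
  by case: eqP => // <-.
by rewrite mulrC mcoeffMX.
Qed.

Lemma dhomog1_expand (l : R) : l \is 1.-homog -> l = \sum_i l@_U_(i) *: 'X_i.
Proof.
move=> hl; apply/mpolyP => m; rewrite raddf_sum /=.
under eq_bigr do rewrite mcoeffZ mcoeffX.
have [/mdeg1P [j /eqP ->]|ne] := boolP (mdeg m == 1%N).
  rewrite (bigD1 j) //= eqxx mulr1 big1 ?addr0 // => i ij.
  by rewrite eq_mnm1 (negPf ij) mulr0.
rewrite (dhomog_nemf_coeff hl) // big1 // => i _.
by case: eqP => [im|_]; [rewrite -im mdeg1 in ne | rewrite mulr0].
Qed.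

Lemma mcoeff_linM (l p : R) m : l \is 1.-homog ->
  (l * p)@_m = \sum_i l@_U_(i) * (if (0 < m i)%N then p@_(m - U_(i)) else 0).
Proof.
move=> hl; rewrite {1}(dhomog1_expand hl) mulr_suml raddf_sum /=.
by apply: eq_bigr => i _; rewrite -scalerAl mcoeffZ mcoeffXM.
Qed.

(** [q] lives in the degree of [m], so only the constant term of [p] contributes. *)
Lemma mcoeff_homogM k (p q : R) m : q \is k.-homog -> mdeg m = k ->
  (p * q)@_m = p@_0 * q@_m.
Proof.
move=> hq dm; elim/mpolyind: p => [|c m' p _ _ IH]; first by rewrite mul0r !mcoeff0 mul0r.
rewrite mulrDl !mcoeffD IH mulrDl -scalerAl !mcoeffZ mcoeffX -mulrA; congr (_ * _ + _).
have [->|ne] := eqVneq; first by rewrite mpolyX0 !mul1r.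
have hX : 'X_[m'] * q \is (mdeg m' + k).-homog.
  by apply: dhomogM => //; rewrite dhomogX.
by rewrite mul0r (dhomog_nemf_coeff hX) //= dm -{1}[k]add0n eqn_add2r eq_sym mdeg_eq0.
Qed.

Variable H : rel 'I_n.
Hypothesis Hsym : ssrbool.symmetric H.

(** Each monomial of [p] is divisible by some [X_k X_l] with [H k l], and in degree 2 it equals that
    product. *)
Lemma edge_ideal_coef (p : R) i j :
  edge_ideal H p -> ~~ H i j -> p@_(U_(i) + U_(j)) = 0.
Proof.
case=> a -> Hij; rewrite raddf_sum big1 // => k _; rewrite raddf_sum big1 // => l Hkl /=.
rewrite -mulrA mulrC -mulrA !mcoeffXM mnmBE !mnmDE !mnm1E.
case: ifP => //; rewrite addn_gt0 !lt0b; case: ifP => // + kij.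
case/orP: kij => /eqP ?; subst k.
- rewrite addKn lt0b => /eqP ?; subst l; by rewrite Hkl in Hij.
- rewrite addnK lt0b => /eqP ?; subst l; by rewrite Hsym Hkl in Hij.
Qed.

Lemma mcoeff_lin_edge (l p : R) a b t :
    l \is 1.-homog -> edge_ideal H p -> a != b -> a != t -> b != t ->
    ~~ H a t -> ~~ H b t ->
  (l * p)@_(U_(a) + U_(b) + U_(t)) = l@_U_(t) * p@_(U_(a) + U_(b)).
Proof.
move=> hl Ip ab atn bt Hat Hbt; rewrite mcoeff_linM // (bigD1 t) //= big1 ?addr0.
  by rewrite !mnmDE !mnm1E eqxx addn1 addmK.
move=> i it; rewrite !mnmDE !mnm1E [t == i]eq_sym (negPf it) addn0 addn_gt0 !lt0b.
case: ifP => [/orP[]/eqP ?|_]; last by rewrite mulr0.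
- by subst i; rewrite -addmA addmC addmK (edge_ideal_coef Ip Hbt) mulr0.
- by subst i; rewrite [(U_(a) + _)%MM]addmC -addmA addmC addmK (edge_ideal_coef Ip Hat) mulr0.
Qed.

(* Two edges [ab] and [cd] forming an induced [2K_2] have a Koszul syzygy of
   degree 2, and it is not a combination of linear ones. *)
Theorem linear_resolution_no_2K2 a b c d :
    H a b -> H c d -> [/\ ~~ H a c, ~~ H a d, ~~ H b c & ~~ H b d] ->
    [/\ a != b, a != c, a != d, b != c & b != d] ->
  ~ linear_resolution (@edge_ideal K _ H).
Proof.
move=> Hab Hcd [ac ad bc bd] [nab nac nad nbc nbd].
case=> [L [r [g [D [[hg hD Ig] [Dg ex0 _ _ _]]]]]].
have Igk k : edge_ideal H (g k 0).
  by apply/Ig; exists (delta_mx 0 k); rewrite -rowE mxE.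
have /Ig [A defA] := edge_ideal_gen K Hab.
have /Ig [B defB] := edge_ideal_gen K Hcd.
(* The Koszul syzygy, written through the linear syzygies. *)
have [v defv] : exists v : 'rV_(r 1%N), ('X_c * 'X_d) *: A - ('X_a * 'X_b) *: B = v *m D 0%N.
  have scal (p : R) (M : 'M_1) : p = M 0 0 -> M = p%:M.
    by move=> ->; apply: mx11_eq; rewrite mxE.
  apply: ex0; rewrite mulmxBl -!scalemxAl (scal _ _ defA) (scal _ _ defB).
  by rewrite !scale_scalar_mx mulrC subrr.
(* Pairing with [y] detects the generator [X_a X_b]. *)
pose y k := (g k 0)@_(U_(a) + U_(b)).
(* Read off the coefficient of [X_a X_b X_t] in the relation [D g = 0]. *)
have lin j t : a != t -> b != t -> ~~ H a t -> ~~ H b t ->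
    \sum_k (D 0%N j k)@_U_(t) * y k = 0.
  move=> nat nbt Hat Hbt.
  have /(congr1 (fun M : 'cV__ => (M j 0)@_(U_(a) + U_(b) + U_(t)))) := Dg.
  rewrite !mxE mcoeff0 raddf_sum => E; rewrite -[RHS]E; apply: eq_bigr => k _.
  by rewrite /= mcoeff_lin_edge.
(* At [X_c X_d] the Koszul syzygy has the constant terms of [A] as coefficients, and these pair with
   [y] to the coefficient of [X_a X_b] in [A g = X_a X_b]. *)
have : \sum_k ((v *m D 0%N) 0 k)@_(U_(c) + U_(d)) * y k = 1.
  transitivity (((A *m g) 0 0)@_(U_(a) + U_(b))).
    rewrite mxE raddf_sum; apply: eq_bigr => k _ /=.
    rewrite (mcoeff_homogM _ (hg k)); last by rewrite mdegD !mdeg1.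
    congr (_ * _); rewrite -defv !mxE mcoeffB -!mulrA !mcoeffXM !mnmBE !mnmDE !mnm1E.
    rewrite ![_ == a]eq_sym (negPf nac) (negPf nad) /= subr0 !eqxx /=.
    by rewrite addKn /= addmC addmK -[X in (X - _)%MM]add0m addmK.
  by rewrite -defA mcoeffXM mnmDE mnm1E eqxx /= addmC addmK mcoeffX eqxx.
(* Only the coefficients of [D] at [X_c] and [X_d] contribute to [X_c X_d], and [lin] kills both. *)
suff -> : \sum_k ((v *m D 0%N) 0 k)@_(U_(c) + U_(d)) * y k = 0.
  by move/eqP; rewrite eq_sym oner_eq0.
under eq_bigr do rewrite mxE raddf_sum mulr_suml.
rewrite exchange_big big1 // => j _ /=.
under eq_bigr do rewrite [v 0 j * _]mulrC mcoeff_linM // mulr_suml.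
rewrite exchange_big big1 // => i _ /=.
rewrite mnmDE !mnm1E addn_gt0 !lt0b; case: ifP => ci; last first.
  by rewrite big1 // => k _; rewrite mulr0 mul0r.
under eq_bigr do rewrite mulrAC.
rewrite -mulr_suml; have -> : \sum_k (D 0%N j k)@_U_(i) * y k = 0.
  by case/orP: ci => /eqP <-; apply: lin.
by rewrite mul0r.
Qed.

End Obstruction.

(** * Three-vertex paths and centers in trees *)

Section Trees.

Variables (V : finType) (e : rel V).

Definition P3 a b c := [&& e a b, e b c & a != c].

Definition hits u := forall a b c, P3 a b c -> u \in [:: a; b; c].

(* In a tree: the components of the graph minus [u] are single vertices and single edges,
   each attached to [u] by one of its vertices. *)
Definition center u :=
  (forall x, x != u -> e u x \/ exists2 y, e u y & e y x) /\
  (forall y x x', e u y -> e y x -> e y x' -> x != u -> x' != u -> x = x').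

Hypotheses (e_sym : ssrbool.symmetric e) (e_irr : ssrbool.irreflexive e).

Lemma edge_neq a b : e a b -> a != b.
Proof. by apply: contraTneq => ->; rewrite e_irr. Qed.

Lemma edge_neqC a b : e a b -> b != a.
Proof. by rewrite eq_sym; apply: edge_neq. Qed.

Section Acyclic.

Hypothesis acyc : acyclic e.

Lemma no_C3 a b c : e a b -> e b c -> e c a -> False.
Proof.
move=> ab bc ca; apply: acyc; exists [:: a; b; c]; split=> //=; last first.
  by rewrite ab bc ca.
by rewrite !inE !negb_or (edge_neq ab) (edge_neqC ca) (edge_neq bc).
Qed.

Lemma no_C4 a b c d : e a b -> e b c -> e c d -> e d a -> a != c -> b != d -> False.
Proof.
move=> ab bc cd da ac bd; apply: acyc; exists [:: a; b; c; d]; split=> //=; last first.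
  by rewrite ab bc cd da.
rewrite !inE !negb_or (edge_neq ab) ac (edge_neqC da) (edge_neq bc) bd.
by rewrite (edge_neq cd).
Qed.

(* No distinctness is needed: a degenerate closed walk of length 5 contains a triangle. *)
Lemma no_C5 a b c d f : e a b -> e b c -> e c d -> e d f -> e f a -> False.
Proof.
move=> ab bc cd df fa.
have [?|ac] := eqVneq a c; first by subst c; apply: no_C3 cd df fa.
have [?|ad] := eqVneq a d; first by subst d; apply: no_C3 ab bc cd.
have [?|bd] := eqVneq b d; first by subst d; apply: no_C3 ab df fa.
have [?|bf] := eqVneq b f; first by subst f; apply: no_C3 bc cd df.
have [?|cf] := eqVneq c f; first by subst f; apply: no_C3 ab bc fa.
apply: acyc; exists [:: a; b; c; d; f]; split=> //=; last first.
  by rewrite ab bc cd df fa.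
rewrite !inE !negb_or (edge_neq ab) ac ad (edge_neqC fa) (edge_neq bc) bd bf.
by rewrite (edge_neq cd) cf (edge_neq df).
Qed.

Lemma mem3 (x a b c : V) : x \in [:: a; b; c] -> [\/ x = a, x = b | x = c].
Proof. by rewrite !inE => /or3P[]/eqP; [constructor 1|constructor 2|constructor 3]. Qed.

(** The link runs inside the path, through its middle vertex if necessary; it supplies arcs that
    close up short cycles. *)
Lemma P3_link a b c x y w : P3 a b c ->
    x \in [:: a; b; c] -> y \in [:: a; b; c] -> w \notin [:: a; b; c] -> x != y ->
  e x y \/ exists z, [/\ z != w, e x z & e z y].
Proof.
case/and3P=> ab bc ac; rewrite !inE !negb_or => + + /and3P[wa wb wc].
have bw : b != w by rewrite eq_sym.
have [ba cb] : e b a /\ e c b by rewrite e_sym ab e_sym.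
by case/or3P=> /eqP -> /or3P[] /eqP ->; rewrite ?eqxx // => _;
  (by left) || (by right; exists b).
Qed.

(** If [v] is missed by no path, it serves. Otherwise take a path with middle [b]; if [b] is missed
    as well, some neighbour [v2] of [b] lies on all paths, since failure would close a cycle of
    length at most 5. *)
Lemma P3_disjoint_hits (v : V) :
    (forall a b c a' b' c', P3 a b c -> P3 a' b' c' ->
      exists2 z, z \in [:: a; b; c] & z \in [:: a'; b'; c']) ->
  exists u, hits u.
Proof.
move=> meet.
pose miss u := [exists a, exists b, exists c, P3 a b c && (u \notin [:: a; b; c])].
have hitsN u : ~~ miss u -> hits u.
  move=> nm a b c abc; apply: contraNT nm => nu.
  by apply/existsP; exists a; apply/existsP; exists b; apply/existsP; exists c; rewrite abc.
have missP u : miss u -> exists a b c, P3 a b c /\ u \notin [:: a; b; c].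
  by case/existsP=> a /existsP[b /existsP[c /andP[]]]; exists a, b, c.
have [/missP [a [b [c [abc _]]]]|/hitsN] := boolP (miss v); last by exists v.
have [/missP [a' [b' [c' [abc' nb]]]]|/hitsN] := boolP (miss b); last by exists b.
(* The path missing [b] meets [a b c] in an end [v2] and continues from there to some [v3] other
   than [b]. *)
have [v0 [v2 [v3 [v01 v12 v23 n02 n13]]]] : exists v0 v2 v3,
    [/\ e v0 b, e b v2, e v2 v3, v0 != v2 & b != v3].
  have [ab bc ac] := and3P abc; have [ab' bc' ac'] := and3P abc'.
  have [z zabc zabc'] := meet _ _ _ _ _ _ abc abc'.
  have zb : z != b by apply: contraNneq nb => <-.
  have [y [by_ zy]] : exists y, b != y /\ e z y.
    move: zabc' nb; rewrite !inE !negb_or => + /and3P[ba bb bc2].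
    by case/or3P=> /eqP ->; [exists b' | exists a' | exists b']; rewrite // e_sym.
  move: zabc; rewrite !inE (negPf zb) /= => /orP[] /eqP ?; subst z.
    by exists c, a, y; split; rewrite // 1?e_sym // eq_sym.
  by exists a, c, y.
have [/missP [x [y [z [xyz nv2]]]]|/hitsN] := boolP (miss v2); last by exists v2.
have [v10 v21 v32] : [/\ e b v0, e v2 b & e v3 v2] by split; rewrite e_sym.
have [v012 v123] : P3 v0 b v2 /\ P3 b v2 v3 by rewrite /P3 v01 v12 v23 n02 n13.
(* A path avoiding [b] and [v2] would contain [v0] and [v3], and its link between them would close a
   cycle with [v0 b v2 v3]. *)
have hit12 p q r : P3 p q r -> b \notin [:: p; q; r] -> v2 \in [:: p; q; r].
  move=> pqr nbQ; apply/negPn/negP => nv2Q.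
  have v0Q : v0 \in [:: p; q; r].
    have [t + tQ] := meet _ _ _ _ _ _ v012 pqr.
    by case/mem3=> ?; subst t => //; [rewrite tQ in nbQ | rewrite tQ in nv2Q].
  have v3Q : v3 \in [:: p; q; r].
    have [t + tQ] := meet _ _ _ _ _ _ v123 pqr.
    by case/mem3=> ?; subst t => //; [rewrite tQ in nbQ | rewrite tQ in nv2Q].
  have n03 : v0 != v3 by apply/eqP => ?; subst v3; apply: no_C3 v01 v12 v23.
  have [v03|[t [_ v0t tv3]]] := P3_link pqr v0Q v3Q nbQ n03.
    by apply: no_C4 v10 v03 v32 v21 _ n02; rewrite n13.
  by apply: no_C5 v10 v0t tv3 v32 v21.
have v2Q : v2 \in [:: a'; b'; c'] by apply: hit12.
have bQ' : b \in [:: x; y; z] by apply: contraNT nv2; apply: hit12.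
exfalso.
(* A common vertex [t] is linked to [v2] off [b] and to [b] off [v2]; with the edge [b v2] this
   closes a cycle of length 3, 4 or 5. *)
have [t tQ tQ'] := meet _ _ _ _ _ _ abc' xyz.
have tb : t != b by apply: contraNneq nb => <-.
have tv2 : t != v2 by apply: contraNneq nv2 => <-.
have [t2|[s [sb ts s2]]] := P3_link abc' tQ v2Q nb tv2;
  have [t1|[r [rb tr r1]]] := P3_link xyz tQ' bQ' nv2 tb.
- by apply: no_C3 t2 v21 _; rewrite e_sym.
- by apply: no_C4 tr r1 v12 _ tb rb; rewrite e_sym.
- apply: (no_C4 ts s2 v21 _ tv2 sb); by rewrite e_sym.
- by apply: no_C5 ts s2 v21 _ _; [rewrite e_sym; exact: r1 | rewrite e_sym].
Qed.

(** A repetition-free path from [u] with three edges or more contains a three-vertex path avoiding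
    [u], and so does a branching at a neighbour of [u]. *)
Lemma hits_center u : connected e -> hits u -> center u.
Proof.
move=> conn hu; split=> [x xu|y x x' uy yx yx' xu xu'].
  have /connectP [p] := conn u x; case/shortenP=> p' pp up _ defx.
  case: p' pp up defx => [|a [|b [|c p']]] /=.
  - by move=> _ _ defx; rewrite defx eqxx in xu.
  - by move=> /andP[ua _] _ ->; left.
  - by move=> /and3P[ua ab _] _ ->; right; exists a.
  - move=> /and4P[_ ab bc _] /and4P[uabc abc _ _] _.
    have /hu : P3 a b c.
      by rewrite /P3 ab bc; move: abc; rewrite !inE !negb_or => /and3P[].
    by move: uabc; rewrite !inE !negb_or => /and4P[/negPf -> /negPf -> /negPf ->].
apply: contraTeq isT => xx'; have /hu : P3 x y x' by rewrite /P3 e_sym yx yx'.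
rewrite !inE ![u == _]eq_sym (negPf xu) (negPf xu') orbF /= => /eqP yu.
by rewrite yu e_irr in uy.
Qed.

(** Two neighbours of [u] would give a triangle, two vertices at distance 2 a closed walk of length
    5. *)
Lemma center_edge u x y : center u -> e x y -> x != u -> y != u ->
  (e u x && ~~ e u y) || (e u y && ~~ e u x).
Proof.
move=> [Cu _] xy xu yu; have yx : e y x by rewrite e_sym.
have [ux|nux] := boolP (e u x); have [uy|nuy] := boolP (e u y) => //=.
  by case: (no_C3 ux xy); rewrite e_sym.
have [ux|[x' ux' xx']] := Cu _ xu; first by rewrite ux in nux.
have [uy|[y' uy' yy']] := Cu _ yu; first by rewrite uy in nuy.
case: (no_C5 ux' xx' xy (f := y')); by rewrite e_sym.
Qed.

(** The leaves are the neighbours of [u], the whiskers the vertices at distance 2; [f] picks the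
    common neighbour with [u], unique for lack of 4-cycles. *)
Lemma center_pw_star u : center u -> is_pw_star e.
Proof.
move=> cu; have [Cu Cu'] := cu.
pose f x := odflt u [pick y | e u y && e y x].
have fP x : x != u -> ~~ e u x -> e u (f x) && e (f x) x.
  move=> xu nux; rewrite /f; case: pickP => //= none.
  case: (Cu _ xu) => [ux|[y uy yx]]; first by rewrite ux in nux.
  by have := none y; rewrite uy yx.
have f_uniq x y : x != u -> ~~ e u x -> e u y -> e y x -> y = f x.
  move=> xu nux uy yx; have /andP[uf fx] := fP _ xu nux.
  apply: contraTeq isT => yf; case: (no_C4 uy yx (c := x) (d := f x)) => //.
  - by rewrite e_sym.
  - by rewrite e_sym.
  - by rewrite eq_sym.
exists u, [set x | e u x], [set x | (x != u) && ~~ e u x], f; split.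
  split; rewrite ?inE ?e_irr ?eqxx //.
    by rewrite -setI_eq0; apply/eqP/setP => x; rewrite !inE; case: (e u x); rewrite ?andbF.
  by move=> x; rewrite !inE; case: eqP => //= _; case: (e u x).
split=> [x x'|x|x y]; rewrite !inE.
- move=> /andP[xu nux] /andP[xu' nux'] fxx'.
  have /andP[uf fx] := fP _ xu nux; have /andP[_ fx'] := fP _ xu' nux'.
  by apply: Cu' uf fx _ xu xu'; rewrite fxx'.
- by case/andP=> xu nux; have /andP[-> _] := fP _ xu nux; rewrite orbT.
apply/idP/idP => [xy|].
  have [xu|xu] := eqVneq x u; first by subst x; rewrite xy.
  have [yu|yu] := eqVneq y u; first by subst y; rewrite e_sym xy orbT.
  case/orP: (center_edge cu xy xu yu) => /andP[up nuq].
    by rewrite nuq (f_uniq y x) // eqxx !orbT.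
  by rewrite nuq -(f_uniq x y) ?eqxx ?orbT // e_sym.
case/or4P=> /andP[].
- by move/eqP->.
- by move/eqP->; rewrite e_sym.
- by case/andP=> xu nux /eqP ->; have /andP[_] := fP _ xu nux; rewrite e_sym.
- by case/andP=> yu nuy /eqP ->; have /andP[_] := fP _ yu nuy.
Qed.

End Acyclic.
End Trees.

(** * Every family of the list has a center *)

Section Cases.

Variables (V : finType) (e : rel V).

Lemma star_center : is_star e -> exists u, center e u.
Proof.
move=> [u eE]; exists u; split=> [x xu|y x x' uy + _ xu _].
  by left; rewrite eE eqxx eq_sym xu.
rewrite eE (negPf xu) orbF => /andP[_ /eqP yu].
by rewrite yu eE eqxx in uy.
Qed.

Lemma pw_star_center : is_pw_star e -> exists u, center e u.
Proof.
move=> [u [L [W [f [[uL uW LW cov] [f_inj fW eE]]]]]].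
have LWF x : x \in L -> x \in W -> False.
  by move=> xL xW; move/disjointFr: LW => /(_ x xL); rewrite xW.
exists u; split=> [x xu|y x x' uy yx yx' xu xu'].
  have /or3P[|xL|xW] := cov x; first by rewrite (negPf xu).
    by left; rewrite eE eqxx xL.
  have /orP[/eqP fx|fx] := fW x xW; first by left; rewrite eE xW fx eqxx !orbT.
  by right; exists (f x); rewrite eE ?eqxx ?fx ?xW ?orbT.
(* Beyond a neighbour of [u] there are only whiskers attached to it. *)
have child z : e y z -> z != u -> z \in W /\ y = f z.
  rewrite eE => /or4P[] /andP[].
  - move=> /eqP yu zL _; rewrite yu eE eqxx (negPf uL) (negPf uW) /= in uy.
    by [].
  - by move=> /eqP ->; rewrite eqxx.
  - move=> yW /eqP -> fyu; have fyL : f y \in L by have := fW y yW; rewrite (negPf fyu).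
    move: uy; rewrite eE (negPf uL) (negPf uW) /= => /or3P[].
    + by rewrite eqxx /= => /LWF /(_ yW).
    + by rewrite andbF.
    + by case/andP=> _; rewrite eq_sym (negPf fyu).
  - by move=> zW /eqP ->.
have [xW yfx] := child x yx xu; have [xW' yfx'] := child x' yx' xu'.
by apply: f_inj => //; rewrite -yfx.
Qed.

(** The center is the vertex at position [m]; the bounds leave at most two vertices on either side
    of it. *)
Lemma indexed_path_center (p : seq V) m :
    (forall x, x \in p) ->
    (forall x y, e x y = ((index x p).+1 == index y p) || ((index y p).+1 == index x p)) ->
    uniq p -> (m < size p <= m + 3)%N -> (m <= 2)%N ->
  exists u, center e u.
Proof.
move=> cov eE up /andP[mp pm] m2.
have u0 : V by case: p mp {cov eE up pm}.
have ix i : (i < size p)%N -> index (nth u0 p i) p = i by move=> ip; apply: index_uniq.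
have lt_ix x : (index x p < size p)%N by rewrite index_mem.
have inj x y : index x p = index y p -> x = y.
  by move=> xy; rewrite -(nth_index u0 (cov x)) xy nth_index.
exists (nth u0 p m); split=> [x xu|y x x'].
  have xm : index x p != m by apply: contraNneq xu => <-; rewrite nth_index.
  have := lt_ix x; rewrite eE ix // => xp.
  have [x1|x1] := boolP ((m.+1 == index x p) || ((index x p).+1 == m)); [by left | right].
  exists (nth u0 p (if (m < index x p)%N then m.+1 else m.-1));
    rewrite eE !ix //; case: ifP => ?; lia.
rewrite !eE ix // => uy yx yx' xu xu'; apply: inj.
have xm z : z != nth u0 p m -> index z p != m.
  by apply: contraNneq => <-; rewrite nth_index.
have := xm x xu; have := xm x' xu'; have := lt_ix x; have := lt_ix x'; lia.
Qed.

Lemma path_center n : (2 <= n <= 5)%N -> is_path_graph e n -> exists u, center e u.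
Proof.
move=> n25 [p [sp up cov eE]].
apply: (indexed_path_center (m := if n == 5 then 2 else 1)%N cov eE up);
  rewrite ?sp; case: ifP => ?; lia.
Qed.

Lemma broom_center n m : is_broom e n m -> has_diameter e 3 -> exists u, center e u.
Proof.
move=> [p [w [[sp n0 sw upw cov] eE]]] [diam _].
have [a hd ia] : exists2 a, (forall x, head x p = a) & index a p = 0%N.
  by case: p sp {upw cov eE} => [sp|a p _]; [rewrite -sp in n0 | exists a; rewrite //= eqxx].
move: upw; rewrite cat_uniq => /and3P[up /hasPn npw uw].
have inp x : (x \in p) = (x \notin w).
  have := cov x; rewrite mem_cat; have [xw _|_] := boolP (x \in w).
    by apply/negbTE/npw.
  by rewrite orbF.
have inw x : (x \in w) = (x \notin p) by rewrite inp negbK.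
have ap : a \in p by rewrite -index_mem ia sp.
have eqa x : (x == a) = (x \in p) && (index x p == 0%N).
  apply/eqP/andP => [->|[xp /eqP ix]]; first by rewrite ia.
  by rewrite -(nth_index a xp) ix nth0 hd.
have ixn x : x \in p -> (index x p < n)%N by rewrite -index_mem sp.
have nix i : (i < n)%N -> nth a p i \in p /\ index (nth a p i) p = i.
  by move=> lt_in; rewrite mem_nth ?index_uniq ?sp.
(* Height along the broom: 0 on the bristles [w], 1 at the head [a]. It changes by at most 1 along
   an edge, so diameter 3 forces [n <= 4], and no bristles if [n = 4]; for [n <= 3] the center is
   [a]. *)
pose h x := if x \in p then (index x p).+1 else 0%N.
have ha : h a = 1%N by rewrite /h ap ia.
have h_step x y : e x y -> (h x <= (h y).+1)%N.
  rewrite eE !hd => /or3P[/andP[/andP[]]| |] /=.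
  - by rewrite /h => -> ->; lia.
  - by case/andP=> xw _; rewrite /h inp xw.
  - by case/andP=> yw /eqP ->; rewrite ha.
have h_path x s : path e x s -> (h x <= h (last x s) + size s)%N.
  elim: s x => [|y s IH] x /=; first by rewrite addn0.
  by case/andP=> /h_step xy /IH; lia.
have far x y : (h x <= h y + 3)%N.
  by have [s [ls ps <-]] := diam x y; have := h_path _ _ ps; lia.
have nth_h i : (i < n)%N -> h (nth a p i) = i.+1.
  by case/nix=> xp ix; rewrite /h xp ix.
have n4 : (n <= 4)%N.
  by case: leqP => // n5; have := far (nth a p 4) a; rewrite nth_h // ha.
have [n3|n3] := leqP n 3; last first.
  have wP x : x \in p.
    rewrite inp; apply/negP => xw.
    by have := far (nth a p 3) x; rewrite nth_h // /h inp xw.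
  apply: (indexed_path_center (m := 1%N) wP _ up); rewrite ?sp; [|lia|lia].
  by move=> x y; rewrite eE !inw !wP /= orbF.
exists a; split=> [x xa|y x x' ay yx yx' xa xa'].
  have [xp|xw] := boolP (x \in p); last first.
    by left; rewrite eE !hd eqxx !inw xw !orbT.
  have := ixn _ xp; move: xa; rewrite eqa xp /= => x0 xn.
  have [x1|x1] := boolP (index x p == 1%N).
    by left; rewrite eE xp ap (eqP x1) ia.
  have [|yp iy] := nix 1%N; first by lia.
  by right; exists (nth a p 1); rewrite eE ?xp ?ap yp ?ia iy //=; lia.
have yp : y \in p.
  rewrite inp; apply/negP => yw; move: yx; rewrite eE !hd inp yw (negPf xa) /=.
  by case/andP=> _; rewrite eqa inp yw.
have ya : y != a.
  by apply/eqP => ya; move: ay; rewrite ya eE hd ia inw ap.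
have child z : e y z -> z != a -> (z \in p) && (index z p == 2%N).
  move=> yz za; move: yz ay; rewrite !eE !hd !inw yp ap ia.
  rewrite (negPf za) (negPf ya) !andbF !orbF /= => /andP[zp] yz y1.
  move: za; rewrite eqa zp /=; have := ixn _ zp; lia.
have /andP[xp /eqP ix] := child _ yx xa; have /andP[xp' /eqP ix'] := child _ yx' xa'.
by rewrite -(nth_index a xp) ix -ix' nth_index.
Qed.

End Cases.

(** * From the tree to the edge ideal of its line graph *)

Section LineGraph.

Variables (K : fieldType) (V : finType) (e : rel V).
Hypotheses (e_sym : ssrbool.symmetric e) (e_irr : ssrbool.irreflexive e).

Local Notation E i := (enum_val (A := edges e) i).

Lemma mem_edges x y : e x y -> [set x; y] \in edges e.
Proof.
move=> xy; rewrite inE; apply/existsP; exists x.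
by apply/existsP; exists y; rewrite xy /=.
Qed.

Lemma edges_at u s : s \in edges e -> u \in s -> exists2 z, e u z & s = [set u; z].
Proof.
rewrite inE => /existsP[x /existsP[y /andP[xy /eqP ->]]]; rewrite !inE => /orP[]/eqP ->.
  by exists y.
by exists x; rewrite 1?e_sym // setUC.
Qed.

Lemma edge_index x y : e x y -> exists i, E i = [set x; y].
Proof.
move=> xy; exists (enum_rank_in (mem_edges xy) [set x; y]).
by rewrite enum_rankK_in ?mem_edges.
Qed.

Lemma line_graph_sym : ssrbool.symmetric (line_graph e).
Proof. by move=> i j; rewrite /line_graph eq_sym setIC. Qed.

Lemma meetP (A B : {set V}) : reflect (exists2 x, x \in A & x \in B) (A :&: B != set0).
Proof.
apply: (iffP (set0Pn _)) => [[x /setIP[]]|[x xA xB]]; exists x => //.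
by rewrite inE xA.
Qed.

(** The two edges of a three-vertex path are adjacent in the line graph, so two disjoint such paths
    give an induced [2K_2]. *)
Lemma linear_resolution_P3 a b c a' b' c' :
    linear_resolution (@edge_ideal K _ (line_graph e)) ->
    P3 e a b c -> P3 e a' b' c' ->
  exists2 z, z \in [:: a; b; c] & z \in [:: a'; b'; c'].
Proof.
move=> res abc abc'; apply/hasP; rewrite has_sym; apply/negPn/negP => disj.
have {}disj z : z \in [:: a; b; c] -> z \in [:: a'; b'; c'] -> False.
  by move=> zQ zQ'; case/hasP: disj; exists z.
have adj x y z : P3 e x y z -> exists i j, [/\ line_graph e i j, i != j,
    forall t, t \in E i -> t \in [:: x; y; z] & forall t, t \in E j -> t \in [:: x; y; z]].
  case/and3P=> /[dup] xy /edge_index [i Ei] /[dup] yz /edge_index [j Ej] xz.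
  have ij : i != j.
    apply/eqP => ij; move: Ei; rewrite ij Ej => /setP /(_ x).
    by rewrite !inE eqxx (negPf xz) orbF => /eqP xy'; rewrite xy' e_irr in xy.
  exists i, j; split=> //.
  - by rewrite /line_graph ij; apply/meetP; exists y; rewrite ?Ei ?Ej !inE eqxx ?orbT.
  - by move=> t; rewrite Ei !inE => /orP[]->; rewrite ?orbT.
  - by move=> t; rewrite Ej !inE => /orP[]->; rewrite ?orbT.
have [i [j [Lij nij Ei Ej]]] := adj _ _ _ abc.
have [k [l [Lkl nkl Ek El]]] := adj _ _ _ abc'.
have far p q : (forall t, t \in E p -> t \in [:: a; b; c]) ->
    (forall t, t \in E q -> t \in [:: a'; b'; c']) -> ~~ line_graph e p q /\ p != q.
  move=> Ep Eq; have dpq : ~~ (E p :&: E q != set0).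
    by apply/meetP => -[t /Ep tQ /Eq]; apply: disj.
  split; first by rewrite /line_graph (negPf dpq) andbF.
  apply: contraNneq dpq => <-; rewrite setIid.
  have := enum_valP p; rewrite inE => /existsP[x /existsP[y /andP[_ /eqP ->]]].
  by apply/set0Pn; exists x; rewrite !inE eqxx.
have [ik nik] := far _ _ Ei Ek; have [il nil_] := far _ _ Ei El.
have [jk njk] := far _ _ Ej Ek; have [jl njl] := far _ _ Ej El.
exact: (linear_resolution_no_2K2 line_graph_sym Lij Lkl) res.
Qed.

Hypothesis acyc : acyclic e.
Variable u : V.
Hypothesis cu : center e u.

Lemma edges_off s : s \in edges e -> u \notin s ->
  exists x y, [/\ e y x, e u y, ~~ e u x, x != u & s = [set x; y]].
Proof.
rewrite inE => /existsP[x /existsP[y /andP[xy /eqP ->]]].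
rewrite !inE negb_or ![u == _]eq_sym => /andP[xu yu].
have yx : e y x by rewrite e_sym.
have /orP[/andP[ux uy]|/andP[uy ux]] := center_edge e_sym e_irr acyc cu xy xu yu.
  by exists y, x; rewrite setUC.
by exists x, y.
Qed.

(** Such an edge joins a neighbour [y] of [u] to a vertex [x] at distance 2, and [q] is [uy]. A
    further edge at [x] would close a 4-cycle, one at [y] would contradict [center]. *)
Lemma line_graph_whisker p : u \notin E p ->
  exists q, [/\ u \in E q, E p :&: E q != set0 &
    forall r, r != p -> E p :&: E r != set0 -> r = q].
Proof.
move=> up; have [x [y [yx uy ux xu Ep]]] := edges_off (enum_valP p) up.
have [q Eq] := edge_index uy; exists q; split.
- by rewrite Eq !inE eqxx.
- by apply/meetP; exists y; rewrite ?Ep ?Eq !inE eqxx orbT.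
move=> r rp /meetP [t tp tr].
have [ur|ur] := boolP (u \in E r).
  have [z uz Er] := edges_at (enum_valP r) ur.
  apply: enum_val_inj; rewrite Eq Er; congr [set _; _].
  have tu : t != u by apply: contraNneq up => <-.
  move: tp tr; rewrite Ep Er !inE (negPf tu) /= => /orP[]/eqP -> /eqP // xz.
  by rewrite xz uz in ux.
case/negP: rp; apply/eqP/enum_val_inj; rewrite Ep.
have [x' [y' [yx' uy' ux' xu' Er]]] := edges_off (enum_valP r) ur; rewrite Er.
move: tp tr; rewrite Ep Er !inE => /orP[]/eqP -> /orP[]/eqP tt.
- subst x'; congr [set _; _]; apply/eqP; apply/negPn/negP => yy'.
  by apply: (no_C4 e_irr acyc uy' yx' (d := y)); rewrite // 1?e_sym // eq_sym.
- by rewrite tt uy' in ux.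
- by rewrite -tt uy in ux'.
- by subst y'; rewrite (cu.2 _ _ _ uy yx yx').
Qed.

(** The edges at [u] form the clique [c]; each other edge [p] is pendant, attached to [t p]. *)
Lemma center_linear_resolution : linear_resolution (@edge_ideal K _ (line_graph e)).
Proof.
pose c := [seq i <- enum 'I_#|edges e| | u \in E i].
have mem_c i : (i \in c) = (u \in E i) by rewrite mem_filter mem_enum andbT.
pose t p := odflt p [pick q | (u \in E q) && (E p :&: E q != set0)].
have tP p : p \notin c -> (u \in E (t p)) && (E p :&: E (t p) != set0).
  rewrite mem_c => /line_graph_whisker [q [uq pq _]]; rewrite /t.
  by case: pickP => //= /(_ q); rewrite uq pq.
have t_uniq p r : p \notin c -> r != p -> E p :&: E r != set0 -> r = t p.
  move=> pc rp pr; have /andP[ut pt] := tP _ pc.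
  have [q [_ _ uniq_q]] := line_graph_whisker (p := p) ltac:(by rewrite -mem_c).
  rewrite (uniq_q _ rp pr) (uniq_q _ _ pt) //.
  by apply: contraNneq pc => <-; rewrite mem_c.
apply: (@whiskered_clique_linear_resolution K _ c t).
- by rewrite filter_uniq ?enum_uniq.
- by move=> p /tP /andP[ut _]; rewrite mem_c.
- move=> p q pc qc tpq; apply/eqP; apply: contraNT (qc) => pq.
  have /andP[ut pt] := tP _ pc; have /andP[_ qt] := tP _ qc.
  (* Off [u], both [p] and [q] can meet [t p] only in its other end [z], so they would meet each
     other and [q] would be [t p], an edge at [u]. *)
  suff meet_pq : E p :&: E q != set0.
    by rewrite (t_uniq p q pc _ meet_pq) ?mem_c // eq_sym.
  have [z uz Et] := edges_at (enum_valP _) ut.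
  rewrite -tpq Et in qt; rewrite Et in pt; rewrite !mem_c in pc qc.
  case/meetP: pt => x xp; rewrite !inE => /orP[]/eqP xz; subst x; first by rewrite xp in pc.
  case/meetP: qt => x xq; rewrite !inE => /orP[]/eqP xz; subst x; first by rewrite xq in qc.
  by apply/meetP; exists z.
- move=> i j; rewrite !mem_c => ui uj; rewrite /line_graph andbC.
  by suff -> : E i :&: E j != set0 by []; apply/meetP; exists u.
- move=> p q pc; apply/andP/eqP => [[pq]|->].
    by apply: t_uniq; rewrite 1?eq_sym.
  have /andP[ut pt] := tP _ pc; split=> //.
  by apply: contraNneq pc => ->; rewrite mem_c.
- exact: line_graph_sym.
Qed.

End LineGraph.

Theorem theorem2p9 (K : fieldType) (V : finType) (e : rel V) :
  is_tree e ->
  (linear_resolution (@edge_ideal K _ (line_graph e)) <->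
   [\/ is_star e,
       (exists n m : nat, is_broom e n m) /\ has_diameter e 3,
       is_pw_star e
     | exists n : nat, [/\ (2 <= n)%N, (n <= 5)%N & is_path_graph e n]]).
Proof.
case=> -[e_sym e_irr] /card_gt0P [v _] conn acyc; split=> [res|cases].
  have [a b c a' b' c' abc abc'|u hu] := P3_disjoint_hits e_sym e_irr acyc v.
    exact: linear_resolution_P3 res abc abc'.
  (* A tree with a center is a partially whiskered star. *)
  by constructor 3; apply: (center_pw_star e_sym e_irr acyc (hits_center e_sym e_irr conn hu)).
suff [u cu] : exists u, center e u by exact: center_linear_resolution cu.
case: cases => [|[[n [m]]]||[n [n2 n5]]].
- exact: star_center.
- exact: broom_center.
- exact: pw_star_center.
- by apply: path_center; rewrite n2.
Qed.
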